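(* Let $\alpha>0$. Let $\varphi(z)=a+\lambda z$, where $a\in\mathbb{C}$, $\lambda\in\mathbb{R}$, $-1<\lambda<1$ and $\lambda\neq0$, and put $\beta=1-|\lambda|^2$. Let $\psi(z)=e^{a_0+a_1z+a_2z^2}$ with $a_0,a_1,a_2\in\mathbb{C}$ and $|a_2|=\frac{\alpha}{2}\beta$. Suppose that the weighted composition operator $W_{\psi,\varphi}f=\psi\cdot(f\circ\varphi)$ is bounded on $\mathcal{F}^\infty_\alpha$. Let $z_0=a/(1-\lambda)$ be the fixed point of $\varphi$, let $$c_1=\frac{1}{1-\lambda}\Big(a_1+\lambda a\,\frac{2a_2}{1-\lambda^2}\Big),$$ and let $c_0=\lim_{n\to\infty}c_{0,n}$, with $c_{0,n}$ as defined in the context. Then the function $$F(z)=\exp\left(c_1z+a_2\beta^{-1}z^2\right)$$ belongs to $\mathcal{F}^\infty_\alpha\setminus\mathcal{F}^\infty_{\alpha,0}$. Moreover, for every $f\in\mathcal{F}^\infty_\alpha$, $\psi(z_0)^{-n}W_{\psi,\varphi}^nf\to Wf$ locally uniformly on $\mathbb{C}$ as $n\to\infty$, where $$(Wf)(z)=c\,F(z)\,f(z_0),\qquad c=e^{c_0}.$$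
   Context: For $\alpha>0$, $\mathcal{F}^\infty_\alpha$ is the Banach space of entire functions $f:\mathbb{C}\to\mathbb{C}$ with finite norm $\|f\|=\sup_{z\in\mathbb{C}}|f(z)|e^{-\frac{\alpha}{2}|z|^2}$. The space $\mathcal{F}^\infty_{\alpha,0}$ is the closed subspace of $\mathcal{F}^\infty_\alpha$ of entire functions with $\lim_{z\to\infty}f(z)e^{-\frac{\alpha}{2}|z|^2}=0$. Boundedness of $W_{\psi,\varphi}$ on $\mathcal{F}^\infty_\alpha$ means it maps $\mathcal{F}^\infty_\alpha$ into itself and is a bounded linear operator there. $W_{\psi,\varphi}^n$ is the $n$-th iterate (power) of the operator. Let $g(z)=a_0+a_1z+a_2z^2$, so $\psi=e^g$, and let $\varphi_k$ be the $k$-fold composition of $\varphi$ with itself ($\varphi_0$ the identity), so $\varphi_k(z)=z_0(1-\lambda^k)+\lambda^kz$. Set $c_{0,n}=\sum_{k=0}^{n-1}\big(g(\varphi_k(0))-g(z_0)\big)$, which converges as $n\to\infty$; it is the constant term in the exponent of the formula $(W_{\psi,\varphi}^nf)(z)=\psi(z_0)^n\exp\big(c_{0,n}+c_{1,n}z+a_2\frac{1-\lambda^{2n}}{1-\lambda^2}z^2\big)f(\varphi_n(z))$, where $c_{1,n}\to c_1$. *)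

(* Defs.v *)
From Stdlib Require Import Reals.
From Coquelicot Require Import Coquelicot.

Local Open Scope R_scope.

(** Coquelicot has no complex exponential. *)
Definition Cexp (z : C) : C :=
  (exp (Re z) * cos (Im z), exp (Re z) * sin (Im z)).

Definition entire (f : C -> C) : Prop :=
  forall z : C, @ex_derive C_AbsRing C_NormedModule f z.

Definition fock_weight (alpha : R) (z : C) : R :=
  exp (- (alpha / 2) * Cmod z ^ 2).

(** The norm takes values in [Rbar]: it is [p_infty] when the weighted modulus
    of [f] is unbounded. *)
Definition fock_norm (alpha : R) (f : C -> C) : Rbar :=
  Lub_Rbar (fun x : R => exists z : C, x = Cmod (f z) * fock_weight alpha z).

Definition in_fock (alpha : R) (f : C -> C) : Prop :=
  entire f /\ is_finite (fock_norm alpha f).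

(** The filter [z -> infinity] in the complex plane. *)
Definition C_infty (P : C -> Prop) : Prop :=
  exists M : R, forall z : C, M < Cmod z -> P z.

Definition in_fock0 (alpha : R) (f : C -> C) : Prop :=
  in_fock alpha f /\
  filterlim (fun z : C => Cmult (f z) (RtoC (fock_weight alpha z)))
    C_infty (@locally C_UniformSpace (RtoC 0)).

(** Both norms in the last clause are finite, by [in_fock] and the first clause,
    so that [real] loses no information. *)
Definition bounded_operator_on_fock (alpha : R) (T : (C -> C) -> C -> C) : Prop :=
  (forall f : C -> C, in_fock alpha f -> in_fock alpha (T f)) /\
  (forall (f h : C -> C) (s t : C), in_fock alpha f -> in_fock alpha h ->
     forall z : C,
       T (fun w => Cplus (Cmult s (f w)) (Cmult t (h w))) z =
       Cplus (Cmult s (T f z)) (Cmult t (T h z))) /\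
  (exists M : R, forall f : C -> C, in_fock alpha f ->
     real (fock_norm alpha (T f)) <= M * real (fock_norm alpha f)).

Definition weighted_comp (psi phi : C -> C) (f : C -> C) : C -> C :=
  fun z => Cmult (psi z) (f (phi z)).

(** [u 0 + ... + u (n - 1)]; Coquelicot's [sum_n u m] has [m + 1] terms. *)
Definition Csum (u : nat -> C) (n : nat) : C :=
  match n with
  | O => RtoC 0
  | S m => @sum_n C_AbelianMonoid u m
  end.

Definition c0_seq (g phi : C -> C) (z0 : C) (n : nat) : C :=
  Csum (fun k => Cminus (g (Nat.iter k phi (RtoC 0))) (g z0)) n.

Definition locally_uniform_cv (u : nat -> C -> C) (v : C -> C) : Prop :=
  forall z : C, exists U : C -> Prop,
    @locally C_UniformSpace z U /\
    forall eps : posreal,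
      eventually (fun n => forall w : C, U w -> Cmod (Cminus (u n w) (v w)) < eps).

(* Main.v *)
(** Testing the boundedness of [W] on normalized reproducing kernels shows that
    [|psi z| exp (alpha / 2 (|phi z|^2 - |z|^2))] is bounded.  Along the line
    [R w] with [|w| = 1] and [a2 w^2 = |a2|] the quadratic terms of the exponent
    cancel, so its linear term must vanish, which amounts to [Re (c1 w) = 0].
    Hence the weighted modulus of [F] is bounded, and it equals 1 on [R w].

    For the iterates, expand [g] at the fixed point:
    [g z = g z0 + (1 - lambda) p (z - z0) + (1 - lambda^2) q (z - z0)^2].  The sum
    of [g (phi_k z) - g z0] over [k < n] then telescopes to
    [p (z - z0) (1 - lambda^n) + q (z - z0)^2 (1 - lambda^(2n))]. *)

Require Import Defs.
From Stdlib Require Import Reals Lra.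
From Coquelicot Require Import Coquelicot.

Local Open Scope R_scope.

(** * The complex exponential and its derivative *)

Lemma Cexp_plus (x y : C) : Cexp (x + y) = (Cexp x * Cexp y)%C.
Proof.
  destruct x as [a b], y as [c d]; unfold Cexp, Cmult; simpl.
  rewrite exp_plus, cos_plus, sin_plus.
  f_equal; ring.
Qed.

Lemma Cexp_0 : Cexp 0 = 1.
Proof.
  unfold Cexp; simpl; rewrite exp_0, cos_0, sin_0.
  unfold RtoC; f_equal; ring.
Qed.

Lemma Cmod_Cexp (z : C) : Cmod (Cexp z) = exp (Re z).
Proof.
  unfold Cexp, Cmod; cbn [fst snd].
  replace (_ + _)%R with (exp (Re z) ^ 2).
  - apply sqrt_pow2, Rlt_le, exp_pos.
  - generalize (sin2_cos2 (Im z)); unfold Rsqr; intros H.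
    replace (exp (Re z) ^ 2) with (exp (Re z) ^ 2 * 1) by ring.
    rewrite <- H; ring.
Qed.

Lemma Cexp_neq_0 (z : C) : Cexp z <> 0.
Proof.
  apply Cmod_gt_0; rewrite Cmod_Cexp; apply exp_pos.
Qed.

Lemma Cexp_opp (z : C) : Cexp (- z) = (/ Cexp z)%C.
Proof.
  assert (H : (Cexp z * Cexp (- z))%C = 1)
    by (rewrite <- Cexp_plus, Cplus_opp_r; apply Cexp_0).
  replace (/ Cexp z)%C with (/ Cexp z * 1)%C by ring.
  rewrite <- H; field; apply Cexp_neq_0.
Qed.

Lemma Cmod_le_Rabs_Re_Im (z : C) : Cmod z <= Rabs (Re z) + Rabs (Im z).
Proof.
  replace z with (RtoC (Re z) + Ci * RtoC (Im z))%C at 1.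
  - eapply Rle_trans; [apply Cmod_triangle|].
    rewrite Cmod_mult, Cmod_Ci, !Cmod_R; lra.
  - destruct z as [x y]; unfold Ci, RtoC, Cmult, Cplus; simpl; f_equal; ring.
Qed.

Lemma Rabs_Im_le_Cmod (z : C) : Rabs (Im z) <= Cmod z.
Proof.
  eapply Rle_trans; [|apply Rmax_Cmod]; apply Rmax_r.
Qed.

Lemma Cexp_first_order (eps : posreal) :
  exists delta : posreal, forall h : C, Cmod h < delta ->
    Cmod (Cexp h - 1 - h) <= eps * Cmod h.
Proof.
  (* The four error terms below total at most [6 * eta * m], hence less than [eps * m] for [m > 0];
     [eta <= 1] yields [Rabs (exp x) <= 2]. *)
  pose (eta := Rmin 1 (eps / 9)).
  assert (Heta : 0 < eta)
    by (apply Rmin_pos; [lra | generalize (cond_pos eps); lra]).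
  assert (Heta1 : eta <= 1) by apply Rmin_l.
  assert (Heta2 : eta <= eps / 9) by apply Rmin_r.
  destruct (derivable_pt_lim_exp 0 eta Heta) as [d1 H1].
  destruct (derivable_pt_lim_sin 0 eta Heta) as [d2 H2].
  destruct (derivable_pt_lim_cos 0 eta Heta) as [d3 H3].
  rewrite exp_0 in H1; rewrite sin_0, cos_0 in *.
  assert (Hd : 0 < Rmin (Rmin d1 d2) (Rmin d3 (eta / 2))).
  { repeat apply Rmin_pos; try apply cond_pos; lra. }
  exists (mkposreal _ Hd); cbn [pos]; intros [x y] Hh.
  assert (Hx := re_le_Cmod (x, y)); assert (Hy := Rabs_Im_le_Cmod (x, y)).
  cbn [Re Im fst snd] in Hx, Hy.
  assert (Hmin : Cmod (x, y) < d1 /\ Cmod (x, y) < d2 /\ Cmod (x, y) < d3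
                 /\ Cmod (x, y) < eta / 2).
  { repeat split; eapply Rlt_le_trans; try exact Hh.
    - eapply Rle_trans; [apply Rmin_l|apply Rmin_l].
    - eapply Rle_trans; [apply Rmin_l|apply Rmin_r].
    - eapply Rle_trans; [apply Rmin_r|apply Rmin_l].
    - eapply Rle_trans; [apply Rmin_r|apply Rmin_r]. }
  set (m := Cmod (x, y)) in *.
  (* Turns a difference-quotient bound into a first-order remainder bound that also covers
     [t = 0]. *)
  assert (Q : forall (u : R -> R) (u0 l t d : R), u 0 = u0 ->
    (forall h, h <> 0 -> Rabs h < d -> Rabs ((u (0 + h) - u0) / h - l) < eta) ->
    Rabs t < d -> Rabs (u t - u0 - l * t) <= eta * Rabs t).
  { intros u u0 l t d Hu H Ht; destruct (Req_dec t 0) as [->|Hne].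
    - rewrite Hu; replace (u0 - u0 - l * 0) with 0 by ring.
      rewrite Rabs_R0; lra.
    - specialize (H t Hne Ht); rewrite Rplus_0_l in H.
      replace (u t - u0 - l * t) with (((u t - u0) / t - l) * t) by (field; auto).
      rewrite Rabs_mult; apply Rmult_le_compat_r; [apply Rabs_pos | lra]. }
  assert (E1 := Q exp 1 1 x d1 exp_0 H1 ltac:(lra)).
  assert (E2 := Q sin 0 1 y d2 sin_0 H2 ltac:(lra)).
  assert (E3 := Q cos 1 (- 0) y d3 cos_0 H3 ltac:(lra)).
  assert (Hm : 0 <= m) by apply Cmod_ge_0.
  assert (Hbx : Rabs (exp x - 1) <= eta).
  { replace (exp x - 1) with ((exp x - 1 - 1 * x) + x) by ring.
    eapply Rle_trans; [apply Rabs_triang|].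
    assert (eta * Rabs x <= 1 * Rabs x)
      by (apply Rmult_le_compat_r; [apply Rabs_pos | lra]).
    lra. }
  assert (Hex : Rabs (exp x) <= 2).
  { replace (exp x) with ((exp x - 1) + 1) by ring.
    eapply Rle_trans; [apply Rabs_triang|]; rewrite Rabs_R1; lra. }
  eapply Rle_trans; [apply Cmod_le_Rabs_Re_Im|].
  unfold Cexp; cbn -[exp].
  (* Each product is linearized one factor at a time; besides the remainders of [exp], [cos] and
     [sin] at 0 only the second-order term [(exp x - 1) * y] is left. The [- 0] is the derivative
     [- sin 0] of [cos]. *)
  replace (exp x * cos y + - (1) + - x)
    with ((exp x - 1 - 1 * x) + exp x * (cos y - 1 - - 0 * y)) by ring.
  replace (exp x * sin y + - 0 + - y)
    with (exp x * (sin y - 0 - 1 * y) + (exp x - 1) * y) by ring.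
  assert (Bx : eta * Rabs x <= eta * m) by (apply Rmult_le_compat_l; lra).
  assert (By : eta * Rabs y <= eta * m) by (apply Rmult_le_compat_l; lra).
  assert (T1 : Rabs (exp x * (cos y - 1 - - 0 * y)) <= 2 * (eta * m)).
  { rewrite Rabs_mult; apply Rmult_le_compat; try apply Rabs_pos; lra. }
  assert (T2 : Rabs (exp x * (sin y - 0 - 1 * y)) <= 2 * (eta * m)).
  { rewrite Rabs_mult; apply Rmult_le_compat; try apply Rabs_pos; lra. }
  assert (T3 : Rabs ((exp x - 1) * y) <= eta * m).
  { rewrite Rabs_mult; apply Rmult_le_compat; try apply Rabs_pos; lra. }
  assert (Hfin : eta * m <= eps / 9 * m) by (apply Rmult_le_compat_r; lra).
  eapply Rle_trans; [apply Rplus_le_compat; apply Rabs_triang|].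
  assert (0 <= eps / 9 * m)
    by (apply Rmult_le_pos; generalize (cond_pos eps); lra).
  lra.
Qed.

(** The addition formula moves the estimate to the origin, where the first-order expansion applies
    with tolerance [eps / Cmod (Cexp z)]. *)
Lemma is_derive_Cexp (z : C) :
  @is_derive C_AbsRing C_NormedModule Cexp z (Cexp z).
Proof.
  split.
  - apply is_linear_scal_l.
  - intros x Hx eps.
    apply (@is_filter_lim_locally_unique C_AbsRing (AbsRing_NormedModule C_AbsRing)) in Hx; subst x.
    assert (HM : 0 < Cmod (Cexp z)) by (apply Cmod_gt_0, Cexp_neq_0).
    assert (He : 0 < eps / Cmod (Cexp z))
      by (apply Rdiv_lt_0_compat; [apply cond_pos | exact HM]).
    destruct (Cexp_first_order (mkposreal _ He)) as [d Hd].
    exists d; intros w Hw.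
    change (Cmod (w - z)%C < d) in Hw.
    change (Cmod (Cexp w - Cexp z - (w - z) * Cexp z)%C <= eps * Cmod (w - z)%C).
    specialize (Hd _ Hw); cbn [pos] in Hd.
    replace (Cexp w - Cexp z - (w - z) * Cexp z)%C
      with (Cexp z * (Cexp (w - z) - 1 - (w - z)))%C.
    + rewrite Cmod_mult.
      replace (eps * Cmod (w - z)%C)
        with (Cmod (Cexp z) * (eps / Cmod (Cexp z) * Cmod (w - z)%C))
        by (field; lra).
      apply Rmult_le_compat_l; lra.
    + replace w with (z + (w - z))%C at 3 by ring.
      rewrite Cexp_plus; ring.
Qed.

(** Covers both the reproducing kernels ([c = 0]) and [F] ([m = 0]). *)
Lemma entire_Cexp_quadratic (m b c : C) :
  entire (fun z => Cexp (m + b * z + c * z ^ 2)%C).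
Proof.
  intros z; eexists.
  apply (@is_derive_comp C_AbsRing C_NormedModule Cexp
           (fun z : C => (m + b * z + c * z ^ 2)%C)).
  - apply is_derive_Cexp.
  - apply (is_derive_ext (K := C_AbsRing) (V := AbsRing_NormedModule C_AbsRing)
      (fun z : C => plus (plus m (mult b z)) (mult (mult c z) z))).
    { intros t; change (m + b * t + c * t * t = m + b * t + c * t ^ 2)%C; ring. }
    assert (D : forall k : C, @is_derive C_AbsRing (AbsRing_NormedModule C_AbsRing)
        (fun z : C => mult k z) z (plus (mult zero z) (mult k one))).
    { intros k; apply (@is_derive_mult C_AbsRing (fun _ => k) (fun z => z)); [apply (@is_derive_const C_AbsRing (AbsRing_NormedModule C_AbsRing)) | apply (@is_derive_id C_AbsRing) |].
      intros; apply Cmult_comm. }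
    apply (@is_derive_plus C_AbsRing (AbsRing_NormedModule C_AbsRing)).
    + apply (@is_derive_plus C_AbsRing (AbsRing_NormedModule C_AbsRing)).
      * apply (@is_derive_const C_AbsRing (AbsRing_NormedModule C_AbsRing)).
      * apply D.
    + apply (@is_derive_mult C_AbsRing (fun z => mult c z) (fun z => z)); [apply D | apply (@is_derive_id C_AbsRing) |].
      intros; apply Cmult_comm.
Qed.

(** * Continuity of entire functions and the Fock norm *)

Lemma C_continuous_eps (f : C -> C) (z : C) (eps : posreal) :
  @ex_derive C_AbsRing C_NormedModule f z ->
  exists delta : posreal, forall w, Cmod (w - z) < delta -> Cmod (f w - f z) < eps.
Proof.
  intros H.
  assert (Hc := @ex_derive_continuous _ _ _ _ H).
  destruct (Hc (fun y => Cmod (y - f z)%C < eps)) as [d Hd].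
  - apply (@locally_le_locally_norm C_AbsRing C_NormedModule).
    exists eps; intros y Hy; exact Hy.
  - exists d; intros w Hw; apply Hd; exact Hw.
Qed.

Lemma fock_norm_ub (alpha : R) (f : C -> C) (z : C) :
  in_fock alpha f -> Cmod (f z) * fock_weight alpha z <= real (fock_norm alpha f).
Proof.
  intros [_ Hf]; rewrite <- Hf.
  destruct (Lub_Rbar_correct
    (fun x : R => exists z : C, x = Cmod (f z) * fock_weight alpha z)) as [Hub _].
  specialize (Hub _ (ex_intro _ z eq_refl)).
  unfold is_finite, fock_norm in *; rewrite <- Hf in Hub; exact Hub.
Qed.

Lemma fock_norm_le (alpha : R) (f : C -> C) (K : R) :
  entire f -> (forall z, Cmod (f z) * fock_weight alpha z <= K) ->
  in_fock alpha f /\ 0 <= real (fock_norm alpha f) <= K.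
Proof.
  intros He HK; unfold in_fock, fock_norm, is_finite.
  destruct (Lub_Rbar_correct
    (fun x : R => exists z : C, x = Cmod (f z) * fock_weight alpha z)) as [Hub Hl].
  assert (Hle := Hl (Finite K) ltac:(intros x [z ->]; apply HK)).
  (* The value at 0 shows that the set is nonempty, which excludes [m_infty] and makes the norm
     nonnegative. *)
  assert (Hge := Hub _ (ex_intro _ (RtoC 0) eq_refl)).
  destruct (Lub_Rbar _) as [l| |]; simpl in *; try easy.
  repeat split; auto.
  eapply Rle_trans; [|exact Hge].
  apply Rmult_le_pos; [apply Cmod_ge_0 | apply Rlt_le, exp_pos].
Qed.

Lemma Cmod_Cexp_weight (alpha : R) (u z : C) :
  Cmod (Cexp u) * fock_weight alpha z = exp (Re u - alpha / 2 * Cmod z ^ 2).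
Proof.
  rewrite Cmod_Cexp; unfold fock_weight; rewrite <- exp_plus; f_equal; ring.
Qed.

(** * Quadratic exponents along the maximal direction *)

Lemma exists_Csqrt_unit (u : C) : Cmod u = 1 -> exists w : C, (w ^ 2)%C = u.
Proof.
  intros Hu; destruct u as [x y].
  assert (H : x ^ 2 + y ^ 2 = 1).
  { generalize (Cmod2_alt (x, y)); rewrite Hu; simpl; lra. }
  assert (Hx : -1 <= x <= 1) by (split; nra).
  (* Half-angle formulas: with [x] the cosine of an angle, [p] and [q] are the absolute cosine and
     sine of its half. The sign of [y] decides between [(p, q)] and [(p, - q)]. *)
  pose (p := sqrt ((1 + x) / 2)); pose (q := sqrt ((1 - x) / 2)).
  assert (Hp : p * p = (1 + x) / 2) by (apply sqrt_sqrt; lra).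
  assert (Hq : q * q = (1 - x) / 2) by (apply sqrt_sqrt; lra).
  assert (Hp0 : 0 <= p) by apply sqrt_pos.
  assert (Hq0 : 0 <= q) by apply sqrt_pos.
  assert (Hpq : 2 * (p * q) = Rabs y).
  { rewrite <- sqrt_Rsqr_abs; symmetry; apply sqrt_lem_1.
    - apply Rle_0_sqr.
    - apply Rmult_le_pos; [lra | apply Rmult_le_pos; lra].
    - unfold Rsqr; replace (2 * (p * q) * (2 * (p * q)))
        with (4 * (p * p) * (q * q)) by ring.
      rewrite Hp, Hq; lra. }
  destruct (Rle_dec 0 y) as [Hy|Hy].
  - rewrite Rabs_pos_eq in Hpq by lra.
    exists (p, q); unfold Cpow, Cmult, RtoC; simpl; f_equal; lra.
  - rewrite Rabs_left in Hpq by lra.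
    exists (p, - q); unfold Cpow, Cmult, RtoC; simpl; f_equal; lra.
Qed.

(** For [c] nonzero, [w] is a square root of the unit number [Cconj c / Cmod c]. *)
Lemma exists_maximal_direction (c : C) :
  exists w : C, Cmod w = 1 /\ (c * w ^ 2)%C = Cmod c.
Proof.
  destruct (Req_dec (Cmod c) 0) as [H0|H0].
  - exists 1; split; [apply Cmod_1|].
    rewrite H0; apply Cmod_eq_0 in H0; rewrite H0; ring.
  - assert (Hc : Cmod c <> 0 :> C) by (intros E; apply H0, RtoC_inj, E).
    assert (Hcp : 0 < Cmod c) by (generalize (Cmod_ge_0 c); lra).
    destruct (exists_Csqrt_unit (Cconj c / Cmod c)%C) as [w Hw].
    { rewrite Cmod_div, Cmod_conj, Cmod_R, Rabs_pos_eq by (auto; lra).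
      field; exact H0. }
    exists w; split.
    + assert (H : Cmod w ^ 2 = 1).
      { rewrite <- Cmod_pow, Hw, Cmod_div, Cmod_conj, Cmod_R, Rabs_pos_eq
          by (auto; lra).
        field; exact H0. }
      generalize (Cmod_ge_0 w); nra.
    + rewrite Hw.
      replace (c * (Cconj c / Cmod c))%C with ((c * Cconj c) / Cmod c)%C
        by (field; exact Hc).
      rewrite <- Cmod2_conj, RtoC_pow; field; exact Hc.
Qed.

Lemma exp_le_compat (x y : R) : x <= y -> exp x <= exp y.
Proof.
  intros [H| ->]; [left; apply exp_increasing, H | apply Rle_refl].
Qed.

Lemma linear_exp_bounded (k r M : R) :
  (forall s, exp (k + s * r) <= M) -> r = 0.
Proof.
  intros H; destruct (Req_dec r 0) as [E|E]; [exact E | exfalso].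
  (* This [s] makes the exponent equal to [M], and [exp M >= 1 + M]. *)
  specialize (H ((M - k) / r)).
  replace (k + (M - k) / r * r) with M in H by (field; exact E).
  generalize (exp_ineq1_le M); lra.
Qed.

(** In the coordinate [u = z / w] the quadratic term is [alpha / 2 * u ^ 2]; subtracting the weight
    cancels its [Re u] part and doubles the [Im u] part. *)
Lemma Re_quadratic_rotated (alpha : R) (b c w u : C) :
  Cmod w = 1 -> (c * w ^ 2)%C = RtoC (alpha / 2) ->
  Re (b * (w * u) + c * (w * u) ^ 2)%C - alpha / 2 * Cmod (w * u) ^ 2
  = Re u * Re (b * w) - Im u * Im (b * w) - alpha * Im u ^ 2.
Proof.
  intros Hw Hcw.
  rewrite Cmod_mult, Hw, Rmult_1_l, Cmod2_alt.
  replace (b * (w * u) + c * (w * u) ^ 2)%C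
    with (u * (b * w) + (c * w ^ 2) * (u * u))%C by ring.
  rewrite Hcw, re_plus, re_scal_l, (re_mult u (b * w)), (re_mult u u); field.
Qed.

(** With [Re (b * w) = 0] only a concave quadratic in [Im u] remains, and completing the square
    gives its maximum. *)
Lemma Re_quadratic_rotated_le (alpha : R) (b c w z : C) :
  0 < alpha -> Cmod w = 1 -> (c * w ^ 2)%C = RtoC (alpha / 2) ->
  Re (b * w) = 0 ->
  Re (b * z + c * z ^ 2)%C - alpha / 2 * Cmod z ^ 2
  <= Im (b * w) ^ 2 / (4 * alpha).
Proof.
  intros Ha Hw Hcw Hbw.
  assert (Hw0 : w <> 0) by (intros E; rewrite E, Cmod_0 in Hw; lra).
  replace z with (w * (z / w))%C by (field; exact Hw0).
  rewrite (Re_quadratic_rotated _ _ _ _ _ Hw Hcw), Hbw.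
  set (t := Im (z / w)); set (y := Im (b * w)).
  replace (y ^ 2 / (4 * alpha))
    with (alpha * (t + y / (2 * alpha)) ^ 2 + (- t * y - alpha * t ^ 2))
    by (field; lra).
  assert (0 <= alpha * (t + y / (2 * alpha)) ^ 2)
    by (apply Rmult_le_pos; [lra | apply pow2_ge_0]).
  lra.
Qed.

(** * Consequences of boundedness for the exponent of the weight *)

Lemma Cmod2_plus (x y : C) :
  Cmod (x + y) ^ 2 = Cmod x ^ 2 + 2 * Re (Cconj x * y) + Cmod y ^ 2.
Proof.
  rewrite !Cmod2_alt; destruct x, y; simpl; ring.
Qed.

(* Tested on the normalized reproducing kernels
   [exp (alpha * conj v * z - alpha / 2 * |v|^2)] with [v = phi z]. *)
Lemma bounded_weighted_comp_exp (alpha : R) (g phi : C -> C) :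
  0 < alpha ->
  bounded_operator_on_fock alpha (weighted_comp (fun z => Cexp (g z)) phi) ->
  exists M : R, forall z : C,
    exp (Re (g z) + alpha / 2 * (Cmod (phi z) ^ 2 - Cmod z ^ 2)) <= M.
Proof.
  intros Ha [Hin [_ [M HM]]]; exists (Rabs M); intros z.
  set (v := phi z).
  pose (k := fun x : C =>
    Cexp (RtoC (- (alpha / 2) * Cmod v ^ 2) + alpha * Cconj v * x + 0 * x ^ 2)%C).
  assert (Re_k : forall x, Re (RtoC (- (alpha / 2) * Cmod v ^ 2)
      + alpha * Cconj v * x + 0 * x ^ 2)%C
      = - (alpha / 2) * Cmod v ^ 2 + alpha * Re (Cconj v * x)).
  { intros x.
    replace (RtoC (- (alpha / 2) * Cmod v ^ 2) + alpha * Cconj v * x + 0 * x ^ 2)%C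
      with (RtoC (- (alpha / 2) * Cmod v ^ 2) + alpha * (Cconj v * x))%C by ring.
    rewrite re_plus, re_scal_l, re_RtoC; reflexivity. }
  destruct (fock_norm_le alpha k 1) as [Hk Hnorm].
  - apply entire_Cexp_quadratic.
  - intros x; unfold k; rewrite Cmod_Cexp_weight, Re_k.
    eapply Rle_trans; [apply (exp_le_compat _ 0) | rewrite exp_0; lra].
    (* The exponent is [- alpha / 2 * Cmod (x - v) ^ 2]. *)
    generalize (Cmod2_plus (- v) x); rewrite Cmod_opp, Copp_conj.
    replace (- Cconj v * x)%C with (- (Cconj v * x))%C by ring.
    rewrite re_opp; intros E.
    generalize (pow2_ge_0 (Cmod (- v + x))); nra.
  - assert (H1 := fock_norm_ub alpha _ z (Hin k Hk)).
    assert (H2 := HM k Hk).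
    eapply Rle_trans; [|eapply Rle_trans; [exact H1 | eapply Rle_trans; [exact H2|]]].
    (* At its own centre the kernel has [k v = exp (alpha / 2 * Cmod v ^ 2)]. *)
    + right; unfold weighted_comp; fold v; unfold k.
      rewrite <- Cexp_plus, Cmod_Cexp_weight, re_plus, Re_k; f_equal.
      rewrite Cmult_comm, <- Cmod2_conj, re_RtoC; field.
    + eapply Rle_trans; [apply Rle_abs|]; rewrite Rabs_mult.
      rewrite (Rabs_pos_eq (real _)) by apply Hnorm.
      generalize (Rabs_pos M); nra.
Qed.

(** At [z = s * w] the terms in [s ^ 2] cancel, so the exponent is affine in [s] and bounded above;
    its slope is the real part in question. *)
Lemma affine_gaussian_bounded_direction
  (alpha lambda M : R) (a a0 a1 a2 w : C) :
  Cmod w = 1 -> (a2 * w ^ 2)%C = RtoC (alpha / 2 * (1 - lambda ^ 2)) ->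
  (forall z : C, exp (Re (a0 + a1 * z + a2 * z ^ 2)%C
     + alpha / 2 * (Cmod (a + lambda * z) ^ 2 - Cmod z ^ 2)) <= M) ->
  Re ((a1 + alpha * lambda * Cconj a) * w) = 0.
Proof.
  intros Hw Ha2 HM.
  apply (linear_exp_bounded (Re a0 + alpha / 2 * Cmod a ^ 2) _ M); intros s.
  eapply Rle_trans; [right | apply (HM (s * w)%C)]; f_equal.
  rewrite Cmod2_plus, !Cmod_mult, Hw, !Cmod_R, Rmult_1_r.
  rewrite Rpow_mult_distr, !pow2_abs.
  replace (a0 + a1 * (s * w) + a2 * (s * w) ^ 2)%C
    with (a0 + s * (a1 * w) + s * (s * (a2 * w ^ 2)))%C by ring.
  replace (Cconj a * (lambda * (s * w)))%C
    with (lambda * (s * (Cconj a * w)))%C by ring.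
  replace ((a1 + alpha * lambda * Cconj a) * w)%C
    with (a1 * w + alpha * (lambda * (Cconj a * w)))%C by ring.
  rewrite Ha2, !re_plus, !re_scal_l, re_RtoC; field.
Qed.

(** * Iterates expanded about the fixed point *)

Lemma Csum_S (u : nat -> C) (n : nat) : Csum u (S n) = (Csum u n + u n)%C.
Proof.
  destruct n as [|n]; simpl.
  - rewrite sum_O; ring.
  - rewrite sum_Sn; reflexivity.
Qed.

Lemma iter_affine (phi : C -> C) (l z0 : C) :
  (forall z, phi z = z0 + l * (z - z0))%C ->
  forall n z, Nat.iter n phi z = (z0 + l ^ n * (z - z0))%C.
Proof.
  intros Hphi n z; induction n as [|n IH]; simpl.
  - ring.
  - rewrite IH, Hphi; ring.
Qed.

(** Since [phi_k 0 - z0 = - l ^ k * z0], the factors [1 - l] and [1 - l ^ 2] make both geometric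
    sums telescope. *)
Lemma c0_seq_affine (g phi : C -> C) (l p q z0 : C) :
  (forall z, phi z = z0 + l * (z - z0))%C ->
  (forall z, g z = g z0 + (1 - l) * p * (z - z0)
                   + (1 - l ^ 2) * q * (z - z0) ^ 2)%C ->
  forall n, c0_seq g phi z0 n
    = (- p * z0 * (1 - l ^ n) + q * z0 ^ 2 * (1 - (l ^ n) ^ 2))%C.
Proof.
  intros Hphi Hg n; unfold c0_seq; induction n as [|n IH].
  - simpl; ring.
  - rewrite Csum_S, IH, (Hg (Nat.iter n phi 0)), (iter_affine phi l z0 Hphi), (Cpow_S l n); ring.
Qed.

(** The induction hypothesis is used at [phi z]. The outer application adds [g z - g z0] to the
    exponent, and [(1 - l) + l * (1 - l ^ n) = 1 - l ^ (n + 1)], likewise with [l ^ 2]. *)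
Lemma iter_weighted_comp_affine (g phi f : C -> C) (l p q z0 : C) :
  (forall z, phi z = z0 + l * (z - z0))%C ->
  (forall z, g z = g z0 + (1 - l) * p * (z - z0)
                   + (1 - l ^ 2) * q * (z - z0) ^ 2)%C ->
  forall n z,
    (/ Cexp (g z0) ^ n * Nat.iter n (weighted_comp (fun z => Cexp (g z)) phi) f z
    = Cexp (p * (z - z0) * (1 - l ^ n) + q * (z - z0) ^ 2 * (1 - (l ^ n) ^ 2))
      * f (z0 + l ^ n * (z - z0)))%C.
Proof.
  intros Hphi Hg n; induction n as [|n IH]; intros z.
  - simpl.
    replace (p * (z - z0) * (1 - 1) + q * ((z - z0) * ((z - z0) * 1))
             * (1 - 1 * (1 * 1)))%C with (RtoC 0) by ring.
    replace (z0 + 1 * (z - z0))%C with z by ring.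
    rewrite Cexp_0; field; exact C1_nz.
  - rewrite Nat.iter_succ; unfold weighted_comp at 1.
    assert (Hn : (Cexp (g z0) ^ n)%C <> 0) by apply Cpow_nz, Cexp_neq_0.
    assert (H1 := Cexp_neq_0 (g z0)).
    specialize (IH (phi z)).
    set (v := Nat.iter n _ f (phi z)) in *.
    rewrite Cpow_S.
    transitivity (Cexp (g z - g z0) * (/ Cexp (g z0) ^ n * v))%C.
    { unfold Cminus; rewrite Cexp_plus, Cexp_opp; field; auto. }
    rewrite IH, Hphi, Cmult_assoc, <- Cexp_plus, (Cpow_S l n).
    f_equal.
    + f_equal; rewrite (Hg z); ring.
    + f_equal; ring.
Qed.

(** * Limits of the iterates and of the constant term *)

Lemma Cexp_mult_continuous_at (f : C -> C) (z0 : C) (eps : posreal) :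
  @ex_derive C_AbsRing C_NormedModule f z0 ->
  exists delta : posreal, forall u y : C, Cmod u < delta -> Cmod y < delta ->
    Cmod (Cexp u * f (z0 + y)%C - f z0) < eps.
Proof.
  intros Hf.
  assert (He := cond_pos eps).
  (* [K] bounds [f] wherever it is within 1 of [f z0], so the error of [Cexp u] may be
     [eps / 2 / K]. *)
  pose (K := Cmod (f z0) + 1).
  assert (HK : 0 < K) by (generalize (Cmod_ge_0 (f z0)); unfold K; lra).
  assert (H1 : 0 < Rmin 1 (eps / 2)) by (apply Rmin_pos; lra).
  assert (H2 : 0 < eps / 2 / K) by (apply Rdiv_lt_0_compat; lra).
  destruct (C_continuous_eps f z0 (mkposreal _ H1) Hf) as [d1 Hd1].
  destruct (C_continuous_eps Cexp 0 (mkposreal _ H2)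
    (ex_intro _ _ (is_derive_Cexp 0))) as [d2 Hd2].
  exists (mkposreal _ (Rmin_pos _ _ (cond_pos d1) (cond_pos d2))).
  cbn [pos]; intros u y Hu Hy.
  assert (E1 : Cmod (f (z0 + y)%C - f z0)%C < Rmin 1 (eps / 2)).
  { apply Hd1; replace (z0 + y - z0)%C with y by ring.
    eapply Rlt_le_trans; [exact Hy | apply Rmin_l]. }
  assert (E2 : Cmod (Cexp u - 1) < eps / 2 / K).
  { rewrite <- Cexp_0; apply Hd2; replace (u - 0)%C with u by ring.
    eapply Rlt_le_trans; [exact Hu | apply Rmin_r]. }
  assert (M1 := Rmin_l 1 (eps / 2)); assert (M2 := Rmin_r 1 (eps / 2)).
  replace (Cexp u * f (z0 + y)%C - f z0)%C
    with ((Cexp u - 1) * f (z0 + y)%C + (f (z0 + y)%C - f z0))%C by ring.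
  eapply Rle_lt_trans; [apply Cmod_triangle|]; rewrite Cmod_mult.
  assert (E3 : Cmod (f (z0 + y)%C) <= K).
  { replace (f (z0 + y)%C) with ((f (z0 + y)%C - f z0) + f z0)%C by ring.
    eapply Rle_trans; [apply Cmod_triangle|]; unfold K; lra. }
  assert (Cmod (Cexp u - 1) * Cmod (f (z0 + y)%C) <= eps / 2 / K * K)
    by (apply Rmult_le_compat; try apply Cmod_ge_0; lra).
  replace (eps / 2 / K * K) with (eps / 2) in * by (field; lra).
  lra.
Qed.

Lemma Cpow_to_0 (l : C) (K eps : R) :
  Cmod l < 1 -> 0 <= K -> 0 < eps ->
  eventually (fun n => Cmod (l ^ n) * K < eps).
Proof.
  intros Hl HK He.
  assert (Hl' : Rabs (Cmod l) < 1) by (rewrite Rabs_pos_eq; [exact Hl | apply Cmod_ge_0]).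
  (* [K + 1] instead of [K] keeps the divisor positive when [K = 0]. *)
  assert (He' : 0 < eps / (K + 1)) by (apply Rdiv_lt_0_compat; lra).
  destruct (pow_lt_1_zero _ Hl' _ He') as [N HN].
  exists N; intros n Hn; specialize (HN n Hn).
  rewrite Cmod_pow.
  rewrite Rabs_pos_eq in HN by apply pow_le, Cmod_ge_0.
  assert (Hp : 0 <= Cmod l ^ n) by apply pow_le, Cmod_ge_0.
  apply Rle_lt_trans with (Cmod l ^ n * (K + 1)); [nra|].
  apply Rmult_lt_reg_r with (/ (K + 1)); [apply Rinv_0_lt_compat; lra|].
  replace (Cmod l ^ n * (K + 1) * / (K + 1)) with (Cmod l ^ n) by (field; lra).
  exact HN.
Qed.

Lemma Cmod_pow_le_1 (l : C) (n : nat) : Cmod l < 1 -> Cmod (l ^ n) <= 1.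
Proof.
  intros Hl; rewrite Cmod_pow, <- (pow1 n).
  apply pow_incr; split; [apply Cmod_ge_0 | lra].
Qed.

Lemma iterates_locally_uniform_cv (f : C -> C) (l p q z0 : C) :
  Cmod l < 1 -> @ex_derive C_AbsRing C_NormedModule f z0 ->
  locally_uniform_cv
    (fun n z => Cexp (p * (z - z0) * (1 - l ^ n)
                      + q * (z - z0) ^ 2 * (1 - (l ^ n) ^ 2))
                * f (z0 + l ^ n * (z - z0)))%C
    (fun z => Cexp (p * (z - z0) + q * (z - z0) ^ 2) * f z0)%C.
Proof.
  intros Hl Hf z; exists (fun w => Cmod (w - z) < 1); split.
  { apply (@locally_le_locally_norm C_AbsRing C_NormedModule).
    exists (mkposreal _ Rlt_0_1); intros y Hy; exact Hy. }
  intros eps.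
  (* On the unit disc about [z], [r] bounds the distance to [z0] and [K] the modulus of the limit
     exponent. *)
  pose (r := Cmod (z - z0) + 1); pose (K := Cmod p * r + Cmod q * r ^ 2).
  assert (Hr : 0 <= r) by (generalize (Cmod_ge_0 (z - z0)); unfold r; lra).
  assert (HK : 0 <= K).
  { apply Rplus_le_le_0_compat; apply Rmult_le_pos; try apply Cmod_ge_0; auto.
    apply pow2_ge_0. }
  assert (He : 0 < eps / exp K)
    by (apply Rdiv_lt_0_compat; [apply cond_pos | apply exp_pos]).
  destruct (Cexp_mult_continuous_at f z0 (mkposreal _ He) Hf) as [d Hd].
  (* [K + r] makes both the exponent error and the displacement [l ^ n * (w - z0)] smaller than
     [d]. *)
  destruct (Cpow_to_0 l (K + r) d Hl ltac:(lra) (cond_pos d)) as [N HN].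
  exists N; intros n Hn w Hw; specialize (HN n Hn).
  assert (Hl1 := Cmod_pow_le_1 l n Hl).
  assert (Hl0 := Cmod_ge_0 (l ^ n)).
  assert (Hwr : Cmod (w - z0) <= r).
  { replace (w - z0)%C with ((w - z) + (z - z0))%C by ring.
    eapply Rle_trans; [apply Cmod_triangle|]; unfold r; lra. }
  assert (Hw0 := Cmod_ge_0 (w - z0)).
  (* Used with [s = t = 1] for the limit exponent [L], and with [s = 1], [t = l ^ n] for its error
     [u]. *)
  assert (Hquad : forall s t : C, Cmod s <= 1 -> Cmod t <= 1 ->
    Cmod (p * (w - z0) * s + q * (w - z0) ^ 2 * t) <= K).
  { intros s t Hs Ht.
    eapply Rle_trans; [apply Cmod_triangle|]; rewrite !Cmod_mult, Cmod_pow.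
    assert (Hw2 : Cmod (w - z0) ^ 2 <= r ^ 2) by (apply pow_incr; lra).
    apply Rplus_le_compat.
    - rewrite <- (Rmult_1_r (Cmod p * r)).
      apply Rmult_le_compat; try apply Cmod_ge_0; auto.
      + apply Rmult_le_pos; apply Cmod_ge_0.
      + apply Rmult_le_compat_l; [apply Cmod_ge_0 | exact Hwr].
    - rewrite <- (Rmult_1_r (Cmod q * r ^ 2)).
      apply Rmult_le_compat; try apply Cmod_ge_0; auto.
      + apply Rmult_le_pos; [apply Cmod_ge_0 | apply pow2_ge_0].
      + apply Rmult_le_compat_l; [apply Cmod_ge_0 | exact Hw2]. }
  pose (u := (- (l ^ n) * (p * (w - z0) * 1 + q * (w - z0) ^ 2 * l ^ n))%C).
  set (L := (p * (w - z0) + q * (w - z0) ^ 2)%C).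
  replace (p * (w - z0) * (1 - l ^ n) + q * (w - z0) ^ 2 * (1 - (l ^ n) ^ 2))%C
    with (L + u)%C by (unfold L, u; ring).
  rewrite Cexp_plus.
  replace (Cexp L * Cexp u * f (z0 + l ^ n * (w - z0))%C - Cexp L * f z0)%C
    with (Cexp L * (Cexp u * f (z0 + l ^ n * (w - z0))%C - f z0))%C by ring.
  rewrite Cmod_mult.
  assert (HL : Cmod (Cexp L) <= exp K).
  { rewrite Cmod_Cexp; apply exp_le_compat.
    eapply Rle_trans; [apply Rle_abs|].
    eapply Rle_trans; [apply re_le_Cmod|].
    replace L with (p * (w - z0) * 1 + q * (w - z0) ^ 2 * 1)%C
      by (unfold L; ring).
    apply Hquad; rewrite Cmod_1; lra. }
  apply Rle_lt_trans with
    (exp K * Cmod (Cexp u * f (z0 + l ^ n * (w - z0))%C - f z0)).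
  - apply Rmult_le_compat_r; [apply Cmod_ge_0 | exact HL].
  - replace (pos eps) with (exp K * (eps / exp K))
      by (field; apply Rgt_not_eq, exp_pos).
    apply Rmult_lt_compat_l; [apply exp_pos|].
    apply Hd.
    + unfold u; rewrite Cmod_mult, Cmod_opp.
      assert (HQ := Hquad 1 (l ^ n)%C ltac:(rewrite Cmod_1; lra) Hl1).
      set (Q := Cmod (_ + _)) in *; nra.
    + rewrite Cmod_mult; nra.
Qed.

Lemma geometric_combination_cv (l s t : C) :
  Cmod l < 1 ->
  filterlim (fun n => s * (1 - l ^ n) + t * (1 - (l ^ n) ^ 2))%C
    eventually (@locally C_UniformSpace (s + t)%C).
Proof.
  intros Hl P HP.
  apply (@locally_norm_le_locally C_AbsRing C_NormedModule) in HP.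
  destruct HP as [eps Heps].
  assert (HK : 0 <= Cmod s + Cmod t)
    by (generalize (Cmod_ge_0 s) (Cmod_ge_0 t); lra).
  destruct (Cpow_to_0 l (Cmod s + Cmod t) eps Hl HK (cond_pos eps)) as [N HN].
  exists N; intros n Hn; apply Heps.
  change (Cmod (s * (1 - l ^ n) + t * (1 - (l ^ n) ^ 2) - (s + t))%C < eps).
  replace (s * (1 - l ^ n) + t * (1 - (l ^ n) ^ 2) - (s + t))%C
    with (- (l ^ n * (s + t * l ^ n)))%C by ring.
  rewrite Cmod_opp, Cmod_mult.
  eapply Rle_lt_trans; [|exact (HN n Hn)].
  apply Rmult_le_compat_l; [apply Cmod_ge_0|].
  eapply Rle_trans; [apply Cmod_triangle|]; rewrite Cmod_mult.
  generalize (Cmod_pow_le_1 l n Hl) (Cmod_ge_0 t); nra.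
Qed.

(** * Failure of decay along a line *)

Lemma not_in_fock0_of_ray (alpha : R) (F : C -> C) (w : C) :
  Cmod w = 1 ->
  (forall s : R, Cmod (F (w * s)%C) * fock_weight alpha (w * s) = 1) ->
  ~ in_fock0 alpha F.
Proof.
  intros Hw Hray [_ Hlim].
  destruct (Hlim (fun y => Cmod y < 1)) as [M HM].
  { apply (@locally_le_locally_norm C_AbsRing C_NormedModule).
    exists (mkposreal _ Rlt_0_1); intros y Hy.
    replace y with (y - 0)%C by ring; exact Hy. }
  (* This point has modulus [Rabs M + 1 > M], whatever the sign of [M]. *)
  specialize (HM (w * RtoC (Rabs M + 1))%C); specialize (Hray (Rabs M + 1)).
  rewrite (Cmod_mult w), (Cmod_mult (F _)), Hw, !Cmod_R in HM.
  assert (0 <= Rabs M) by apply Rabs_pos.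
  rewrite (Rabs_pos_eq (Rabs M + 1)) in HM by lra.
  rewrite (Rabs_pos_eq (fock_weight _ _)) in HM by apply Rlt_le, exp_pos.
  rewrite Hray in HM.
  generalize (Rle_abs M); lra.
Qed.

Theorem theorem4p4 :
  forall (alpha : R) (a : C) (lambda : R) (a0 a1 a2 : C),
  (0 < alpha)%R ->
  (-1 < lambda < 1)%R ->
  lambda <> 0%R ->
  let beta : R := (1 - Rabs lambda ^ 2)%R in
  let phi : C -> C := fun z => (a + lambda * z)%C in
  let g : C -> C := fun z => (a0 + a1 * z + a2 * z ^ 2)%C in
  let psi : C -> C := fun z => Cexp (g z) in
  let W : (C -> C) -> C -> C := weighted_comp psi phi in
  Cmod a2 = (alpha / 2 * beta)%R ->
  bounded_operator_on_fock alpha W ->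
  let z0 : C := (a / (1 - lambda))%C in
  let c1 : C :=
    (1 / (1 - lambda) * (a1 + lambda * a * (2 * a2 / (1 - lambda ^ 2))))%C in
  let F : C -> C := fun z => Cexp (c1 * z + a2 * / beta * z ^ 2)%C in
  (in_fock alpha F /\ ~ in_fock0 alpha F) /\
  exists c0 : C,
    filterlim (c0_seq g phi z0) eventually (@locally C_UniformSpace c0) /\
    forall f : C -> C, in_fock alpha f ->
      locally_uniform_cv
        (fun n z => (/ (psi z0) ^ n * Nat.iter n W f z)%C)
        (fun z => (Cexp c0 * F z * f z0)%C).
Proof.
  intros alpha a lambda a0 a1 a2 Halpha Hlambda _ beta phi g psi W Ha2 HW z0 c1 F.
  assert (Hbeta : beta = 1 - lambda ^ 2) by (unfold beta; rewrite pow2_abs; reflexivity).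
  assert (Hb0 : 0 < beta) by (rewrite Hbeta; nra).
  assert (HbC : RtoC beta = (1 - lambda ^ 2)%C)
    by (rewrite Hbeta, RtoC_minus, RtoC_pow; reflexivity).
  assert (Hl1 : (1 - lambda)%C <> 0).
  { rewrite <- RtoC_minus; intros E; apply RtoC_inj in E; lra. }
  assert (Hl2 : (1 - lambda ^ 2)%C <> 0).
  { rewrite <- HbC; intros E; apply RtoC_inj in E; lra. }
  assert (Hl : Cmod lambda < 1) by (rewrite Cmod_R; apply Rabs_def1; lra).
  split.
  - destruct (exists_maximal_direction a2) as [w [Hw Ha2w]].
    (* The size assumed for [a2] gives the quadratic coefficient of [F] exactly the growth rate of
       the weight along [w]. *)
    assert (Hcw : (a2 * / beta * w ^ 2)%C = RtoC (alpha / 2)).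
    { transitivity (a2 * w ^ 2 / beta)%C; [unfold Cdiv; ring|].
      rewrite Ha2w, Ha2, <- RtoC_div by lra; f_equal; field; lra. }
    assert (Hww : (w * Cconj w)%C = 1) by (rewrite <- Cmod2_conj, Hw; f_equal; ring).
    destruct (bounded_weighted_comp_exp alpha g phi Halpha HW) as [M HM].
    assert (Hdir : Re ((a1 + alpha * lambda * Cconj a) * w) = 0).
    { apply (affine_gaussian_bounded_direction alpha lambda M a a0 a1 a2 w Hw).
      - rewrite Ha2w, Ha2, Hbeta; reflexivity.
      - exact HM. }
    assert (Hc1 : Re (c1 * w) = 0).
    { (* [2 a2 / beta * w = alpha * conj w], and [a * conj w] and [conj a * w]
         have the same real part. *)
      replace (c1 * w)%C with
        (/ (1 - lambda) * (a1 * w + lambda * (alpha * (a * Cconj w))))%C.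
      - rewrite <- RtoC_minus, <- RtoC_inv, re_scal_l by lra.
        replace ((a1 + alpha * lambda * Cconj a) * w)%C
          with (a1 * w + lambda * (alpha * (Cconj a * w)))%C in Hdir by ring.
        rewrite re_plus, !re_scal_l in Hdir |- *.
        replace (Re (a * Cconj w)) with (Re (Cconj a * w)).
        + rewrite Hdir; ring.
        + rewrite <- (re_conj (Cconj a * w)), Cmult_conj, Cconj_conj; reflexivity.
      - assert (E : (2 * a2 / (1 - lambda ^ 2) * w)%C = (alpha * Cconj w)%C).
        { transitivity (2 * (a2 * / beta * w ^ 2) * Cconj w)%C.
          - rewrite HbC.
            transitivity (2 * a2 / (1 - lambda ^ 2) * w * (w * Cconj w))%C;
              [rewrite Hww; ring | unfold Cdiv; ring].
          - rewrite Hcw, RtoC_div by lra.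
            field; intros E2; apply RtoC_inj in E2; lra. }
        unfold c1.
        transitivity (/ (1 - lambda) *
          (a1 * w + lambda * a * (2 * a2 / (1 - lambda ^ 2) * w)))%C;
          [rewrite E; ring | unfold Cdiv; ring]. }
    assert (HFw : forall z, Cmod (F z) * fock_weight alpha z
       = exp (Re (c1 * z + a2 * / beta * z ^ 2)%C - alpha / 2 * Cmod z ^ 2))
      by (intros z; apply Cmod_Cexp_weight).
    split.
    + apply fock_norm_le with (exp (Im (c1 * w) ^ 2 / (4 * alpha))).
      * intros z.
        apply ex_derive_ext with
          (fun z => Cexp (0 + c1 * z + a2 * / beta * z ^ 2)%C).
        { intros t; unfold F; f_equal; ring. }
        apply entire_Cexp_quadratic.
      * intros z; rewrite HFw; apply exp_le_compat.
        apply Re_quadratic_rotated_le; assumption.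
    + apply not_in_fock0_of_ray with w; [exact Hw|]; intros s.
      (* For real [s] the rotated coordinate has no imaginary part and [Re (c1 * w) = 0], so the
         exponent vanishes. *)
      rewrite HFw, (Re_quadratic_rotated _ _ _ _ _ Hw Hcw), Hc1, im_RtoC.
      rewrite <- exp_0; f_equal; ring.
  (* [p] and [q] are the Taylor coefficients of [g] at [z0], divided by [1 - lambda] and
     [1 - lambda ^ 2]. *)
  - pose (p := ((a1 + 2 * a2 * z0) / (1 - lambda))%C).
    pose (q := (a2 / (1 - lambda ^ 2))%C).
    assert (Hphi : forall z, phi z = (z0 + lambda * (z - z0))%C)
      by (intros z; unfold phi, z0; field; exact Hl1).
    assert (Hg : forall z, g z = (g z0 + (1 - lambda) * p * (z - z0)
                   + (1 - lambda ^ 2) * q * (z - z0) ^ 2)%C)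
      by (intros z; unfold g, p, q; field; auto).
    (* The limit exponent [p * (z - z0) + q * (z - z0) ^ 2] at [z = 0]. *)
    exists (- p * z0 + q * z0 ^ 2)%C; split.
    + eapply filterlim_ext; [|apply geometric_combination_cv; exact Hl].
      intros n; symmetry; apply c0_seq_affine; assumption.
    + intros f [Hf _] z.
      destruct (iterates_locally_uniform_cv f lambda p q z0 Hl (Hf z0) z)
        as [U [HU Hcv]].
      exists U; split; [exact HU|]; intros eps.
      destruct (Hcv eps) as [N HN]; exists N; intros n Hn y Hy.
      specialize (HN n Hn y Hy).
      unfold psi, W.
      rewrite (iter_weighted_comp_affine g phi f lambda p q z0 Hphi Hg).
      (* Expanding in powers of [y]: the constant term is [c0], the linear coefficient
         [p - 2 * q * z0] equals [c1], and [q = a2 / beta]. *)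
      replace (Cexp (- p * z0 + q * z0 ^ 2) * F y)%C
        with (Cexp (p * (y - z0) + q * (y - z0) ^ 2)); [exact HN|].
      unfold F; rewrite <- Cexp_plus, HbC; f_equal.
      unfold p, q, c1, z0; field; auto.
Qed.
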